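(* Let $d\ge1$, $\alpha\in[0,2]$ and $c>0$. For $\gamma,a>0$ let $u_a$ be the solution of $$\partial_t u+a\,(-\triangle)^{\alpha/2}u=0,\qquad u(x,0)=\gamma\,\mathbf{1}_Q(\gamma^{-1}x),\qquad Q:=[-1,1]^d,$$ and for $T>0$ set $$\mathrm{Lip}_\varphi(u;c):=\limsup_{a,b\to c}\frac{\|u_a-u_b\|_{C([0,T];L^1)}}{|a-b|},$$ $$\omega_{a-b}:=\begin{cases}|a^{1/\alpha}-b^{1/\alpha}|,&\alpha>1,\\ |a\ln a-b\ln b|,&\alpha=1,\\ |a-b|,&\alpha<1,\end{cases}\qquad \sigma_T:=\begin{cases}T^{1/\alpha},&\alpha>1,\\ T\,|\ln T|,&\alpha=1,\\ T,&\alpha<1,\end{cases}\qquad \sigma_\gamma:=\begin{cases}\gamma^d,&\alpha>1,\\ \gamma^d\ln\gamma,&\alpha=1,\\ \gamma^{d+1-\alpha},&\alpha<1.\end{cases}$$ Then: (i) for all $T,\gamma>0$, $\displaystyle\liminf_{a,b\downarrow0}\frac{\|u_a-u_b\|_{C([0,T];L^1)}}{\omega_{a-b}}>0$; (ii) for all $\gamma>0$, $\displaystyle\liminf_{T\downarrow0}\frac{\mathrm{Lip}_\varphi(u;c)}{\sigma_T}>0$; (iii) for all $T>0$, $\displaystyle\liminf_{\gamma\to+\infty}\frac{\mathrm{Lip}_\varphi(u;c)}{\sigma_\gamma}>0$.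
   Context: The solution $u_a$ is the (unique) entropy solution, which for this linear problem is given by $u_a(\cdot,t)=\mathcal{F}^{-1}\big(e^{-t\,a\,|2\pi\cdot|^\alpha}\,\mathcal{F}u(\cdot,0)\big)$, with $\mathcal{F}\phi(\xi)=\int_{\mathbb{R}^d}e^{-2i\pi x\cdot\xi}\phi(x)\,dx$ (so $(-\triangle)^{\alpha/2}\phi=\mathcal{F}^{-1}(|2\pi\cdot|^\alpha\mathcal{F}\phi)$, the identity for $\alpha=0$ and $-\triangle$ for $\alpha=2$). The solution depends also on $\gamma$ and $\alpha$, and $\mathrm{Lip}_\varphi(u;c)$ depends on $T,\gamma,\alpha,d$; parameters not involved in a given limit are fixed. $\|w\|_{C([0,T];L^1)}=\sup_{t\in[0,T]}\|w(\cdot,t)\|_{L^1(\mathbb{R}^d)}$. In all limits in $(a,b)$, $a\ne b$ are positive. *)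

(* Defs.v *)
From HB Require Import structures.
From mathcomp Require Import all_boot all_order all_algebra.
From mathcomp Require Import complex.
From mathcomp Require Import all_classical all_reals all_analysis.
Set Implicit Arguments.
Unset Strict Implicit.
Unset Printing Implicit Defensive.
Import Order.TTheory GRing.Theory Num.Theory.
Import numFieldTopology.Exports numFieldNormedType.Exports.
Local Open Scope classical_set_scope.
Local Open Scope ring_scope.
Local Open Scope complex_scope.

(* R^d is d.-tuple R with its product sigma-algebra. *)

Section euclidean.
Context {R : realType} {d : nat}.
Implicit Types (x y : d.-tuple R) (k : R).

Definition scalet k x : d.-tuple R := [tuple k * tnth x i | i < d].

Definition dotp x y : R := \sum_(i < d) tnth x i * tnth y i.

(* The norm of 'rV[R]_d in the library is the sup norm, hence this one. *)
Definition enorm x : R := Num.sqrt (dotp x x).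

End euclidean.

Section lebesgue.
Context {R : realType}.

Definition cons_pair n (p : n.-tuple R * measurableTypeR R) : n.+1.-tuple R :=
  [tuple of p.2 :: p.1].

Lemma measurable_cons_pair n : measurable_fun [set: _] (@cons_pair n).
Proof.
apply: (@measurable_cons _ _ _ _ (fun p : n.-tuple R * measurableTypeR R => p.2)
  n (fun p => p.1)).
- exact: measurable_snd.
- exact: measurable_fst.
Qed.

(* The d-dimensional Lebesgue measure: the point mass on R^0, and on R^(n+1)
   the product of the measure of R^n and of the one of R, transported by
   (y, x) |-> x :: y. *)
Fixpoint lebesgue_tuple n : {measure set (n.-tuple R) -> \bar R} :=
  match n with
  | 0 => dirac [tuple]
  | n'.+1 => measure_function_pushforward__canonical__measure_function_Measure
      (lebesgue_tuple n' \x @lebesgue_measure R)%E (@measurable_cons_pair n')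
  end.
End lebesgue.

Section fourier.
Context {R : realType} {d : nat}.
Let mu := @lebesgue_tuple R d.

Definition expi (t : R) : R[i] := cos t +i* sin t.

(* The integral of a complex-valued function, taken componentwise. *)
Definition cintegral (f : d.-tuple R -> R[i]) : R[i] :=
  (\int[mu]_x complex.Re (f x)) +i* (\int[mu]_x complex.Im (f x)).

Definition fourier (phi : d.-tuple R -> R) (xi : d.-tuple R) : R[i] :=
  cintegral (fun x => expi (- (2 * pi * dotp x xi)) * (phi x)%:C).

(* f is F^-1 g, with F acting on L^1(R^d); since F is injective on L^1 this
   determines f almost everywhere.  The integral formula for F^-1 is not an
   option: the transform of an indicator function is not integrable, so that
   formula fails below when t = 0 or alpha = 0. *)
Definition is_inverse_fourier (g : d.-tuple R -> R[i]) (f : d.-tuple R -> R) :=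
  mu.-integrable [set: d.-tuple R] (EFin \o f) /\
  forall xi, fourier f xi = g xi.

End fourier.

Section fractional_heat.
Context {R : realType} (d : nat) (alpha : R).

Definition cube : set (d.-tuple R) :=
  [set x | forall i, tnth x i \in `[-1, 1]%R].

Definition initial_datum (gamma : R) (x : d.-tuple R) : R :=
  gamma * \1_cube (scalet gamma^-1 x).

(* t |-> v t is the entropy solution of
   d_t v + a (- Laplacian)^(alpha/2) v = 0, v 0 = initial_datum gamma,
   namely v t = F^-1 (e^(- t a |2 pi .|^alpha) F (v 0)).
   powR sends (0, 0) to 1, so the multiplier is constant when alpha = 0. *)
Definition is_solution (gamma a : R) (v : R -> d.-tuple R -> R) :=
  v 0 = initial_datum gamma /\
  forall t, 0 <= t -> is_inverse_fourier
    (fun xi => (expR (- (t * a * enorm (scalet (2 * pi) xi) `^ alpha)))%:C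
               * fourier (v 0) xi) (v t).

(* The norm of C([0, T]; L^1(R^d)). *)
Definition normCL1 (T : R) (w : R -> d.-tuple R -> R) : \bar R :=
  ereal_sup [set 'N[lebesgue_tuple d]_1[EFin \o w t]%E | t in `[0, T]].

Definition distCL1 (T : R) (v w : R -> d.-tuple R -> R) : \bar R :=
  normCL1 T (fun t x => v t x - w t x).

(* (a, b) -> (c, c) with a != b positive. *)
Definition distinct_pos_pairs (c : R) : set_system (R * R) :=
  within [set p | [/\ 0 < p.1, 0 < p.2 & p.1 != p.2]] (nbhs (c, c)).

(* Lip_phi(u; c), for the family a |-> u a of solutions. *)
Definition Lip (T : R) (u : R -> R -> d.-tuple R -> R) (c : R) : \bar R :=
  limf_esup (fun p => distCL1 T (u p.1) (u p.2) / `|p.1 - p.2|%:E)%E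
    (distinct_pos_pairs c).

Definition omega (a b : R) : R :=
  if 1 < alpha then `|a `^ alpha^-1 - b `^ alpha^-1|
  else if alpha == 1 then `|a * ln a - b * ln b|
  else `|a - b|.

Definition sigmaT (T : R) : R :=
  if 1 < alpha then T `^ alpha^-1
  else if alpha == 1 then T * `|ln T|
  else T.

Definition sigmag (gamma : R) : R :=
  if 1 < alpha then gamma ^+ d
  else if alpha == 1 then gamma ^+ d * ln gamma
  else gamma `^ (d%:R + 1 - alpha).

End fractional_heat.

(* Main.v *)
From HB Require Import structures.
Require Import Defs.
From mathcomp Require Import all_boot all_order all_algebra.
From mathcomp Require Import complex.
From mathcomp Require Import all_classical all_reals all_analysis.
From mathcomp Require Import measurable_realfun ring lra.
Import Order.TTheory GRing.Theory Num.Theory.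
Import numFieldTopology.Exports numFieldNormedType.Exports.
Local Open Scope classical_set_scope.
Local Open Scope ring_scope.

(* For an integrable w, the norm of w in L^1 bounds the pairing of w with every
   function bounded by 1.  The test functions are the partial sums of the
   Fourier series of a square wave in x_0,
     F_m(y) = sum_(j < m) (-1)^j cos((2j+1) y) / (2j+1),
   which are bounded uniformly in m.  With kappa = pi / (2 gamma), the transform
   of the initial datum at the frequency (2j+1) kappa of the first axis is
   (-1)^j (2 gamma)^d / ((2j+1) kappa), so that for w = u_a(t) - u_b(t) all the
   terms of the pairing with F_m(kappa x_0) have the same sign and add up to
     (2 gamma)^d / kappa * sum_(j < m) (2j+1)^-2 *
       |exp(- t a ((2j+1) kappa)^alpha) - exp(- t b ((2j+1) kappa)^alpha)|.
   As long as t max(a, b) (2 m kappa)^alpha stays bounded, this is of order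
   t |a - b| sum_(j < m) (2j+1)^(alpha - 2), and the largest such m gives the
   three regimes: a convergent sum for alpha < 1, a logarithm for alpha = 1 and
   a power for alpha > 1. *)

(** * Uniform bounds for the partial sums of a square wave *)

(** Summation by parts: apart from two boundary terms, the sum pairs the partial sums of [D],
    bounded by [B], with the decrements of [w], which telescope to [w m - w n]. *)
Lemma abel_sum_bound (R : realFieldType) (D w : nat -> R) (B : R) (m n : nat) :
  (forall j, 0 <= w j) -> (forall j, w j.+1 <= w j) ->
  (forall k, `|\sum_(j < k) D j| <= B) -> (m <= n)%N ->
  `|\sum_(m <= j < n) D j * w j| <= 2 * B * w m.
Proof.
move=> w0 wS DB mn; pose A k := \sum_(j < k) D j.
have AS k : A k.+1 = A k + D k by rewrite /A big_ord_recr.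
have inv : `|\sum_(m <= j < n) D j * w j - A n * w n + A m * w m|
    <= B * (w m - w n).
  elim: n mn => [|n IH].
    by rewrite leqn0 => /eqP ->; rewrite big_geq// add0r addNr normr0 subrr mulr0.
  rewrite leq_eqVlt => /predU1P[->|mn].
    by rewrite big_geq// add0r addNr normr0 subrr mulr0.
  rewrite big_nat_recr//=.
  have -> : \sum_(m <= i < n) D i * w i + D n * w n - A n.+1 * w n.+1 + A m * w m
      = (\sum_(m <= i < n) D i * w i - A n * w n + A m * w m)
        + A n.+1 * (w n - w n.+1).
    by rewrite !AS; ring.
  have -> : B * (w m - w n.+1) = B * (w m - w n) + B * (w n - w n.+1) by ring.
  rewrite (le_trans (ler_normD _ _))// lerD ?IH// normrM.
  have wn : 0 <= w n - w n.+1 by rewrite subr_ge0.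
  by rewrite (ger0_norm wn) ler_wpM2r// DB.
have -> : \sum_(m <= j < n) D j * w j =
    (\sum_(m <= j < n) D j * w j - A n * w n + A m * w m)
    + (A n * w n - A m * w m) by ring.
have -> : 2 * B * w m = B * (w m - w n) + (B * w n + B * w m) by ring.
rewrite (le_trans (ler_normD _ _))// lerD// (le_trans (ler_normB _ _))//.
by apply: lerD; rewrite normrM (ger0_norm (w0 _)) ler_wpM2r// DB.
Qed.

Section square_wave.
Context {R : realType}.
Implicit Types y : R.

Local Notation oddr j := (j.*2.+1%:R : R).

Lemma oddr_gt0 j : 0 < oddr j. Proof. by rewrite ltr0n. Qed.

Lemma oddrE j : oddr j = 2 * j%:R + 1 :> R.
Proof. by rewrite -addn1 natrD -muln2 natrM mulrC. Qed.

(** Induction on the addition formula for (2j+1) y + 2 y, with |sin (2 y)| <= 2 |cos y|. Every term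
    of the square wave is thus at most |cos y| in size, and vanishes with it. *)
Lemma cos_odd_le j y : `|cos (oddr j * y)| <= oddr j * `|cos y|.
Proof.
elim: j => [|j IH]; first by rewrite !mul1r.
have -> : oddr j.+1 * y = oddr j * y + (y + y) by rewrite !oddrE -natr1; ring.
have -> : oddr j.+1 = oddr j + 2 :> R by rewrite !oddrE -natr1; ring.
rewrite cosD mulrDl (le_trans (ler_normB _ _))// lerD//.
  by rewrite normrM (le_trans (ler_piMr _ (cos_max _))).
rewrite sinD normrM -[leRHS]mul1r ler_pM ?sin_max//.
have -> : sin y * cos y + cos y * sin y = 2 * (sin y * cos y) by ring.
by rewrite !normrM ger0_norm// ler_wpM2l// ler_piMl// sin_max.
Qed.

(** The identity 2 cos y cos ((2j+1) y) = cos (2 j y) + cos (2 (j+1) y) makes the alternating sum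
    telescope. *)
Lemma sum_alt_cos_odd n y :
  2 * cos y * \sum_(j < n) ((-1) ^+ j * cos (oddr j * y)) =
  1 - (-1) ^+ n * cos (2 * n%:R * y).
Proof.
elim: n => [|n IH]; first by rewrite big_ord0 mulr0 mulr0 mul0r cos0 mulr1 subrr.
rewrite big_ord_recr/= mulrDr IH.
have -> : 2 * n%:R * y = oddr n * y - y by rewrite oddrE; ring.
have -> : 2 * n.+1%:R * y = oddr n * y + y by rewrite oddrE -natr1; ring.
by rewrite cosB cosD exprS; ring.
Qed.

Definition square_wave n y :=
  \sum_(j < n) ((-1) ^+ j * cos (oddr j * y) / oddr j).

(* With c := |cos y|, the terms are at most c, which settles the first 1 / c of
   them; Abel summation against the partial sums, at most 1 / c, does the
   others. *)
Lemma square_wave_bound n y : `|square_wave n y| <= 3.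
Proof.
pose D j : R := (-1) ^+ j * cos (oddr j * y).
have [c0|c0] := eqVneq (cos y) 0.
  rewrite /square_wave big1 ?normr0// => j _.
  have := cos_odd_le j y; rewrite c0 normr0 mulr0 normr_le0 => /eqP ->.
  by rewrite mulr0 mul0r.
have {}c0 : 0 < `|cos y| by rewrite normr_gt0.
set c := `|cos y| in c0.
have DB k : `|\sum_(j < k) D j| <= c^-1.
  rewrite -(ler_pM2l c0) mulfV ?gt_eqF//.
  rewrite -(ler_pM2l (ltr0Sn R 1)) mulr1 mulrA.
  have -> : 2 * c * `|\sum_(j < k) D j| = `|2 * cos y * \sum_(j < k) D j|.
    by rewrite !normrM (ger0_norm (ler0n R 2)).
  rewrite sum_alt_cos_odd (le_trans (ler_normB _ _))// normr1.
  rewrite -[in leRHS]natr1 mulr1n addrC lerD2r normrM normrX normrN1 expr1n mul1r.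
  exact: cos_max.
have head k : `|\sum_(j < k) (D j / oddr j)| <= k%:R * c.
  rewrite (le_trans (ler_norm_sum _ _ _))//.
  apply: (@le_trans _ _ (\sum_(j < k) c)); last first.
    by rewrite sumr_const card_ord mulr_natl.
  apply: ler_sum => j _.
  rewrite normrM /D normrM normrX normrN1 expr1n mul1r normfV.
  rewrite (ger0_norm (ltW (oddr_gt0 j))) ler_pdivrMr ?oddr_gt0// [leRHS]mulrC.
  exact: cos_odd_le.
have [m /andP[m1 m2]] : exists m : nat, (m%:R <= c^-1) && (c^-1 < m.+1%:R).
  have : 0 <= c^-1 by rewrite invr_ge0 ltW.
  by move=> /Num.Theory.truncn_itv; exists (Num.truncn c^-1).
have mc : m%:R * c <= 1 by rewrite -ler_pdivlMr// mul1r.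
rewrite /square_wave -/(D _); have [nm|mn] := leqP n m.
  rewrite (le_trans (head n))// (@le_trans _ _ 1) ?ler1n//.
  by rewrite (le_trans _ mc)// ler_wpM2r ?ler_nat// ltW.
rewrite -(big_mkord xpredT (fun j => D j / oddr j)).
rewrite (@big_cat_nat _ _ _ m)//=; last exact: ltnW.
rewrite (le_trans (ler_normD _ _))//.
have -> : 3 = 1 + 2 :> R by rewrite -natr1 addrC.
apply: lerD; first by rewrite big_mkord (le_trans (head m)).
apply: le_trans (abel_sum_bound _ _ _ _ _ _ _ _ DB (ltnW mn)) _.
- by move=> j; rewrite invr_ge0 ltW ?oddr_gt0.
- by move=> j; rewrite lef_pV2 ?posrE ?oddr_gt0// ler_nat doubleS ltnS ltnW.
rewrite ler_pdivrMr ?oddr_gt0// ler_wpM2l// (le_trans (ltW m2))// ler_nat ltnS.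
by rewrite -addnn leq_addr.
Qed.

End square_wave.

(** * Growth of the sums of (2j+1)^(alpha - 2) *)

Section rate.
Context {R : realType}.
Implicit Types alpha s : R.

(* The order of sum_(j < m) (2j+1)^(alpha - 2), for the largest m such that
   s m^alpha <= 1, as s goes to 0. *)
Definition rate alpha s :=
  if 1 < alpha then s `^ (alpha^-1 - 1) else if alpha == 1 then - ln s else 1.

Lemma ler_powR_npos (p x y : R) : p <= 0 -> 0 < x -> x <= y -> y `^ p <= x `^ p.
Proof.
move=> p0 x0 xy; rewrite -[p]opprK !(powRN _ (- p)).
have y0 := lt_le_trans x0 xy.
by rewrite lef_pV2 ?posrE ?powR_gt0// ge0_ler_powR ?oppr_ge0 ?nnegrE// ltW.
Qed.

(** Passing from n to n + 1 adds ln (1 + 1/(n+1)) <= 1/(n+1) to the logarithm, and half of that is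
    at most 1/(2n+1). *)
Lemma ln_le_sum_inv_odd n :
  ln n.+1%:R / 2 <= \sum_(j < n) (j.*2.+1%:R : R)^-1.
Proof.
rewrite ler_pdivrMr//; elim: n => [|n IH]; first by rewrite big_ord0 mul0r ln1.
rewrite big_ord_recr/= mulrDl.
have n0 : 0 < n.+1%:R :> R by rewrite ltr0n.
have -> : n.+2%:R = n.+1%:R * (1 + n.+1%:R^-1) :> R.
  by rewrite mulrDr mulr1 mulfV ?gt_eqF// natr1.
have i0 : 0 < n.+1%:R^-1 :> R by rewrite invr_gt0.
rewrite lnM ?posrE ?addr_gt0// lerD//.
rewrite (le_trans (le_ln1Dx (lt_trans (ltrN10 R) i0)))//.
rewrite mulrC ler_pdivlMr ?ltr0n// ler_pdivrMl//.
by rewrite -natrM ler_nat mulnC mul2n -addnn -addnn addSn addnS ltnW.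
Qed.

(** For alpha > 1, n is the integer part of x = s^(-1/alpha), and each term is at least (2n)^(alpha
    - 2) as the exponent is not positive. The sum is then at least (2n)^(alpha - 1) / 2, where 2 n
    >= n + 1 > x because x >= 1. For alpha = 1, n is the integer part of 1/s and the sum is
    logarithmic. For alpha < 1 the first term suffices. *)
Lemma exists_rate_le_sum alpha s : 0 <= alpha <= 2 -> 0 < s <= 1 ->
  exists n, s * n%:R `^ alpha <= 1 /\
    rate alpha s / 2 <= \sum_(j < n) j.*2.+1%:R `^ (alpha - 2).
Proof.
move=> /andP[a0 a2] /andP[s0 s1]; rewrite /rate.
have [a1|] := ltP 1 alpha; last rewrite le_eqVlt => /predU1P[->|a1].
- have alpha0 : 0 < alpha by apply: lt_trans a1.
  pose x := s `^ (- alpha^-1).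
  have x1 : 1 <= x.
    rewrite /x powRN invf_ge1 ?powR_gt0//.
    by rewrite -(powRr0 s) ger_powR ?s0//= invr_ge0.
  have x0 : 0 <= x by apply: le_trans x1.
  have /andP[nx xn] := Num.Theory.truncn_itv x0.
  have n0 : (0 < Num.truncn x)%N by rewrite Num.Theory.truncn_gt0.
  set n := Num.truncn x in nx xn n0; exists n; split.
    have : n%:R `^ alpha <= x `^ alpha by rewrite ge0_ler_powR// nnegrE.
    rewrite /x -powRrM mulNr mulVf ?gt_eqF// powRN (powRr1 (ltW s0)) => h.
    by rewrite mulrC -ler_pdivlMr// mul1r.
  apply: (@le_trans _ _ (\sum_(j < n) (2 * n%:R) `^ (alpha - 2))); last first.
    apply: ler_sum => j _; apply: ler_powR_npos; rewrite ?subr_le0 ?ltr0n//.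
    by rewrite -natrM ler_nat mul2n ltn_double.
  have -> : s `^ (alpha^-1 - 1) = x `^ (alpha - 1).
    by rewrite /x -powRrM; congr (_ `^ _); field; rewrite gt_eqF.
  have n2 : 0 < 2 * n%:R :> R by rewrite mulr_gt0 ?ltr0n.
  rewrite sumr_const card_ord -[leRHS]mulr_natl.
  have -> : n%:R * (2 * n%:R) `^ (alpha - 2) = (2 * n%:R) `^ (alpha - 1) / 2.
    have -> : alpha - 1 = 1 + (alpha - 2) by ring.
    rewrite [X in _ = X / 2]powRD; last by rewrite (gt_eqF n2) implybT.
    by rewrite (powRr1 (ltW n2)); field.
  rewrite ler_pM2r ?invr_gt0//; apply: ge0_ler_powR.
  + by rewrite subr_ge0 ltW.
  + by rewrite nnegrE.
  + by rewrite nnegrE ltW.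
  + by rewrite (le_trans (ltW xn))// -natrM ler_nat mul2n -addnn -addn1 leq_add2l.
- have i0 : 0 <= s^-1 by rewrite invr_ge0 ltW.
  have /andP[nx xn] := Num.Theory.truncn_itv i0.
  rewrite eqxx; exists (Num.truncn s^-1); split.
    by rewrite powRr1// mulrC -ler_pdivlMr// mul1r.
  have -> : 1 - 2 = -1 :> R by ring.
  under eq_bigr do rewrite powR_inv1//.
  apply: le_trans (ln_le_sum_inv_odd _).
  by rewrite ler_pM2r ?invr_gt0// -lnV ?posrE// ler_ln ?posrE ?invr_gt0 ?ltr0n// ltW.
- rewrite (lt_eqF a1); exists 1%N; rewrite powR1 mulr1 big_ord1 powR1.
  by split=> //; rewrite ler_pdivrMr// mul1r ler1n.
Qed.

End rate.

(** * Lebesgue measure on R^n and Fubini's theorem on boxes *)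

Section lebesgue_tuple.
Context {R : realType}.
Local Notation lambda := (@lebesgue_measure R).

Definition box n (r : R) : set (n.-tuple R) :=
  [set x | forall i, tnth x i \in `[- r, r]%R].

Lemma measurable_box n r : measurable (box n r).
Proof.
have -> : box n r = \bigcap_(i in [set: 'I_n])
    ((fun x : n.-tuple R => tnth x i) @^-1` `[- r, r]%classic).
  by apply/seteqP; split=> x /= h i => [_|]; exact: h.
apply: fin_bigcap_measurable; first exact: finite_finset.
move=> i _; rewrite -[X in measurable X]setTI.
by apply: measurable_tnth => //; exact: measurable_itv.
Qed.

Lemma cons_pair_preimage_box n r :
  @cons_pair R n @^-1` box n.+1 r = box n r `*` `[- r, r]%classic.
Proof.
apply/seteqP; split=> -[p y] /=.
  by move=> h; split=> [i|]; [have := h (lift ord0 i); rewrite tnthS|exact: h ord0].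
move=> [hp hy] i; case: (unliftP ord0 i) => [j ->|->]; last by rewrite tnth0.
by rewrite tnthS; exact: hp.
Qed.

Lemma lebesgue_itvNr (r : R) : 0 <= r -> lambda `[- r, r]%classic = (2 * r)%:E.
Proof.
move=> r0; rewrite lebesgue_measure_itv/= lte_fin.
case: ltP => [_|rr]; first by rewrite -EFinD opprK -mulr2n mulr_natl.
by congr EFin; lra.
Qed.

Lemma lebesgue_tuple_box n (r : R) : 0 <= r ->
  lebesgue_tuple n (box n r) = ((2 * r) ^+ n)%:E.
Proof.
move=> r0; elim: n => [|n IH].
  rewrite /= diracE mem_set ?expr0//.
  by move=> [].
rewrite /= /pushforward cons_pair_preimage_box product_measure1E//.
- by rewrite IH [X in (_ * X)%E]lebesgue_itvNr// -EFinM exprSr.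
- exact: measurable_box.
Qed.

Lemma sigma_finite_lebesgue_tuple n :
  sigma_finite [set: n.-tuple R] (lebesgue_tuple n).
Proof.
exists (fun k => box n k%:R).
  apply/esym/seteqP; split=> // x _.
  (* An integer above the l^1 norm of x bounds all its coordinates. *)
  exists (Num.truncn (\sum_(i < n) `|tnth x i|)).+1 => // i.
  rewrite /= in_itv/= -ler_norml ltW//.
  apply: le_lt_trans (Num.Theory.truncnS_gt _).
  by rewrite (bigD1 i)//= lerDl sumr_ge0.
by move=> k; split; [exact: measurable_box|rewrite lebesgue_tuple_box// ltry].
Qed.

(* lebesgue_tuple n is already bundled as a measure; this unbundled copy is able
   to carry the sigma-finite structure that Fubini's theorem asks for. *)
Definition sfin_lebesgue_tuple n : set (n.-tuple R) -> \bar R :=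
  lebesgue_tuple n.

HB.instance Definition _ n := Measure.on (@sfin_lebesgue_tuple n).

HB.instance Definition _ n := @Measure_isSigmaFinite.Build _ _ _
  (@sfin_lebesgue_tuple n) (@sigma_finite_lebesgue_tuple n).

(** Through [cons_pair] the box is a product and the measure a product measure; the integrand
    depends on the second factor only, so the first contributes its volume (2 r)^n. *)
Lemma Rintegral_box n (r : R) (g : R -> R) : 0 <= r ->
  measurable_fun [set: measurableTypeR R] g -> bounded_fun g ->
  \int[lebesgue_tuple n.+1]_(x in box n.+1 r) g (tnth x ord0) =
  (2 * r) ^+ n * \int[lambda]_(y in `[- r, r]) g y.
Proof.
move=> r0 mg bg.
pose m1 : {sigma_finite_measure set (n.-tuple R) -> \bar R} :=
  sfin_lebesgue_tuple n.
pose I : set (measurableTypeR R) := `[- r, r]%classic; pose B := box n r.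
have mI : measurable I by exact: measurable_itv.
have mB : measurable B := measurable_box n r.
have mg1 : measurable_fun [set: n.+1.-tuple R] (fun x => g (tnth x ord0)).
  by apply: measurableT_comp => //; exact: measurable_tnth.
have mg2 : measurable_fun [set: n.-tuple R * measurableTypeR R] (fun p => g p.2).
  by apply: measurableT_comp => //; exact: measurable_snd.
have mX : measurable (B `*` I) by exact: measurableX.
have X_lty : ((m1 \x lambda) (B `*` I) < +oo)%E.
  rewrite product_measure1E// [X in (X * _)%E]lebesgue_tuple_box//.
  by rewrite [X in (_ * X)%E]lebesgue_itvNr// -EFinM ltry.
have ig : (m1 \x lambda)%E.-integrable (B `*` I) (EFin \o (fun p => g p.2)).
  apply: measurable_bounded_integrable => //.
    exact: measurable_funTS.
  case: bg => M [Mr bg]; exists M; split => // x Mx p _; exact: bg.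
have igI : lambda.-integrable I (EFin \o g).
  apply: measurable_bounded_integrable => //.
  - by rewrite [X in (X < _)%E]lebesgue_itvNr// ltry.
  - exact: measurable_funTS.
  - by case: bg => M [Mr bg]; exists M; split => // x Mx p _; exact: bg.
have gE : (EFin \o fun x => g (tnth x ord0)) \o @cons_pair R n =
    EFin \o (fun p => g p.2) by apply/funext.
have m1B : m1 B = ((2 * r) ^+ n)%:E := lebesgue_tuple_box n r r0.
have iB : m1.-integrable setT (EFin \o \1_B).
  apply/integrableP; split; first exact/measurable_EFinP.
  under eq_integral do rewrite /= ger0_norm//.
  by rewrite integral_indic// setIT [X in (X < _)%E]m1B ltry.
(* In the iterated integral, the section at an outer point p gives the inner integral if p is in
   [B], and 0 otherwise. *)
transitivity (\int[m1]_x (\1_B x * \int[lambda]_(y in I) g y)); last first.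
  by rewrite RintegralZr// /Rintegral integral_indic// setIT [X in fine X * _]m1B.
congr fine.
rewrite (@integral_pushforward _ _ _ _ _ _ (@measurable_cons_pair R n)
  (m1 \x lambda)%E (box n.+1 r) (EFin \o fun x => g (tnth x ord0))).
- rewrite gE cons_pair_preimage_box integral_mkcond.
  rewrite -(@integral12_prod_meas1 _ _ _ _ _ m1 lambda); last first.
    exact: (integrable_mkcond _ mX).1 ig.
  apply: eq_integral => p _; rewrite /fubini_F.
  have [pB|pB] := boolP (p \in B).
    rewrite indicE pB mul1r /Rintegral fineK ?integrable_fin_num//.
    rewrite [RHS]integral_mkcond; apply: eq_integral => y _.
    by rewrite !patchE in_setX pB.
  rewrite indicE (negbTE pB) mul0r integral0_eq// => y _.
  by rewrite patchE in_setX (negbTE pB).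
- exact/measurable_EFinP.
- by rewrite cons_pair_preimage_box gE.
- exact: measurable_box.
Qed.
End lebesgue_tuple.

(** * Fourier transforms along the first axis *)

Section fourier_axis.
Context {R : realType}.
Local Notation lambda := (@lebesgue_measure R).
Implicit Types (r k t M alpha gamma a b s : R).

Lemma Rintegral_cos_itvN k r : 0 < k -> 0 < r ->
  \int[lambda]_(y in `[- r, r]) cos (k * y) = 2 * sin (k * r) / k.
Proof.
move=> k0 r0; pose F (y : R) : R := k^-1 * sin (k * y).
have dF (y : R) : is_derive y (1 : R) F (cos (k * y)).
  by apply: is_derive_eq; rewrite /GRing.scale/=; field; rewrite gt_eqF.
have cF : continuous F.
  by move=> y; apply: differentiable_continuous; apply/derivable1_diffP.
rewrite /Rintegral (@continuous_FTC2 _ _ F).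
- by rewrite -EFinB/= /F mulrN sinN; field; rewrite gt_eqF.
- by rewrite gtrN.
- apply: continuous_subspaceT => y.
  apply: continuous_comp; last exact: continuous_cos.
  exact: mulrl_continuous.
- split; first by move=> y _; have [] := dF y.
    exact/cvg_at_right_filter/cF.
  exact/cvg_at_left_filter/cF.
- by move=> y _; rewrite derive1E; have [_ ->] := dF y.
Qed.

(* The point of R^(n+1) whose character has the real part cos (k x_0). *)
Definition axis n k : n.+1.-tuple R := [tuple of k / (2 * pi) :: nseq n 0].

Lemma dotp_axis n k (x : n.+1.-tuple R) :
  2 * pi * dotp x (axis n k) = k * tnth x ord0.
Proof.
rewrite /dotp big_ord_recl big1 => [|i _].
  by rewrite addr0 tnth0; move: pi (pi_gt0 R) => p p0; field; rewrite gt_eqF.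
by rewrite tnthS tnth_nseq mulr0.
Qed.

Lemma enorm_scalet_axis n k : 0 <= k -> enorm (scalet (2 * pi) (axis n k)) = k.
Proof.
move=> k0; rewrite /enorm /dotp big_ord_recl big1 => [|i _].
  rewrite addr0 tnth_mktuple tnth0.
  have -> : 2 * pi * (k / (2 * pi)) = k.
    by move: pi (pi_gt0 R) => p p0; field; rewrite gt_eqF.
  by rewrite -expr2 sqrtr_sqr ger0_norm.
by rewrite tnth_mktuple tnthS tnth_nseq !mulr0.
Qed.

Lemma Re_fourier_axis n k (phi : n.+1.-tuple R -> R) :
  complex.Re (fourier phi (axis n k)) =
  \int[lebesgue_tuple n.+1]_x (cos (k * tnth x ord0) * phi x).
Proof.
rewrite /fourier /cintegral /=; apply: eq_Rintegral => x _.
by rewrite dotp_axis /= mulr0 subr0 cosN.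
Qed.

Lemma initial_datumE n gamma (x : n.-tuple R) : 0 < gamma ->
  initial_datum gamma x = gamma * \1_(box n gamma) x.
Proof.
move=> g0; rewrite /initial_datum; congr (_ * _).
rewrite !indicE; congr (nat_of_bool _)%:R.
apply/idP/idP; rewrite !inE => /= h i; have := h i;
  by rewrite !in_itv/= tnth_mktuple mulrC ler_pdivlMr// ler_pdivrMr// mulN1r mul1r.
Qed.

(** The other n coordinates give (2 gamma)^n; the amplitude gamma of the datum and the 2 of the
    cosine integral supply the last factor 2 gamma. *)
Lemma Rintegral_cos_initial_datum n k gamma : 0 < k -> 0 < gamma ->
  \int[lebesgue_tuple n.+1]_x (cos (k * tnth x ord0) * initial_datum gamma x) =
  (2 * gamma) ^+ n.+1 * sin (k * gamma) / k.
Proof.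
move=> k0 g0.
have -> : (2 * gamma) ^+ n.+1 * sin (k * gamma) / k
    = (2 * gamma) ^+ n * \int[lambda]_(y in `[- gamma, gamma]) (gamma * cos (k * y)).
  rewrite RintegralZl ?Rintegral_cos_itvN//.
    by rewrite exprSr; field; rewrite gt_eqF.
  apply: continuous_compact_integrable; first exact: segment_compact.
  apply: continuous_subspaceT => y.
  apply: continuous_comp; last exact: continuous_cos.
  exact: mulrl_continuous.
rewrite -(@Rintegral_box _ n gamma (fun y => gamma * cos (k * y))) ?(ltW g0)//.
- rewrite [RHS]Rintegral_mkcond; apply: eq_Rintegral => x _.
  rewrite initial_datumE// patchE indicE.
  by case: ifPn => _; rewrite ?mulr1 ?mulr0// mulrC.
- apply: continuous_measurable_fun => y.
  apply: continuousM; first exact: cvg_cst.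
  apply: continuous_comp; last exact: continuous_cos.
  exact: mulrl_continuous.
- exists `|gamma|; split; first exact: num_real.
  move=> M gM y _ /=; rewrite normrM (le_trans _ (ltW gM))//.
  by rewrite ler_piMr// cos_max.
Qed.
End fourier_axis.

(** * Integrals of bounded multiples and of finite sums *)

Section integration.
Context {d} {T : measurableType d} {R : realType}.
Context {mu : {measure set T -> \bar R}}.

Lemma integrable_boundedM (h w : T -> R) :
  measurable_fun [set: _] h -> (exists M, forall x, `|h x| <= M) ->
  mu.-integrable setT (EFin \o w) ->
  mu.-integrable setT (EFin \o (fun x => h x * w x)).
Proof.
move=> mh [M hM] iw.
have -> : EFin \o (fun x => h x * w x) = ((EFin \o h) \* (EFin \o w))%E.
  by apply/funext.
apply: integrableMr => //; exists M; split; first exact: num_real.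
by move=> y My x _; exact: le_trans (hM x) (ltW My).
Qed.

Lemma Rintegral_sum (f : nat -> T -> R) m :
  (forall j, mu.-integrable setT (EFin \o f j)) ->
  \int[mu]_x (\sum_(j < m) f j x) = \sum_(j < m) \int[mu]_x f j x.
Proof.
move=> fi; elim: m => [|m IH].
  by under eq_Rintegral do rewrite big_ord0; rewrite big_ord0 Rintegral_cst// mul0r.
under eq_Rintegral do rewrite big_ord_recr/=.
rewrite RintegralD ?IH ?big_ord_recr//=.
have -> : EFin \o (fun x => \sum_(j < m) f j x) =
    (fun x => \sum_(j < m) (EFin \o f j) x)%E.
  by apply/funext => x /=; rewrite sumEFin.
exact: integrable_sum.
Qed.

End integration.

(** * Pairing of solutions with the square wave *)

Section lower_bound.
Context {R : realType} {n : nat}.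
Local Notation mu := (@lebesgue_tuple R n.+1).
Implicit Types (k t M alpha gamma a b s : R) (w : n.+1.-tuple R -> R).

Lemma measurable_cos_axis k :
  measurable_fun [set: n.+1.-tuple R] (fun x => cos (k * tnth x ord0)).
Proof.
apply: (@measurableT_comp _ _ _ _ _ _ (fun y : R => cos (k * y))); last first.
  exact: measurable_tnth.
apply: continuous_measurable_fun => y.
apply: continuous_comp; last exact: continuous_cos.
exact: mulrl_continuous.
Qed.

Lemma integrable_cosM k w : mu.-integrable setT (EFin \o w) ->
  mu.-integrable setT (EFin \o (fun x => cos (k * tnth x ord0) * w x)).
Proof.
apply: integrable_boundedM; first exact: measurable_cos_axis.
by exists 1 => x; exact: cos_max.
Qed.

Lemma Rintegral_square_wave k w m : mu.-integrable setT (EFin \o w) ->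
  \int[mu]_x (square_wave m (k * tnth x ord0) * w x) =
  \sum_(j < m) (-1) ^+ j / j.*2.+1%:R *
    \int[mu]_x (cos (j.*2.+1%:R * k * tnth x ord0) * w x).
Proof.
move=> iw.
pose f j x := (-1) ^+ j / j.*2.+1%:R * (cos (j.*2.+1%:R * k * tnth x ord0) * w x).
have fi j : mu.-integrable setT (EFin \o f j).
  apply: (@integrable_boundedM _ _ _ _ (cst ((-1) ^+ j / j.*2.+1%:R))) => //.
    by exists `|(-1) ^+ j / j.*2.+1%:R|.
  exact: integrable_cosM.
transitivity (\int[mu]_x (\sum_(j < m) f j x)).
  apply: eq_Rintegral => x _; rewrite /square_wave mulr_suml; apply: eq_bigr => j _.
  by rewrite /f !mulrA; congr (_ * _); rewrite mulrAC.
rewrite Rintegral_sum//; apply: eq_bigr => j _.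
by rewrite RintegralZl//; exact: integrable_cosM.
Qed.

Lemma Rintegral_square_wave_le k w m : mu.-integrable setT (EFin \o w) ->
  (`|\int[mu]_x (square_wave m (k * tnth x ord0) * w x)|%:E <=
   3%:E * 'N[mu]_1[EFin \o w])%E.
Proof.
move=> iw.
have msw : measurable_fun [set: n.+1.-tuple R]
    (fun x => square_wave m (k * tnth x ord0)).
  apply: measurable_sum => j; apply: measurable_funM => //.
  apply: measurable_funM => //; under eq_fun do rewrite mulrA.
  exact: measurable_cos_axis.
have isw : mu.-integrable setT
    (EFin \o (fun x => square_wave m (k * tnth x ord0) * w x)).
  by apply: integrable_boundedM => //; exists 3 => x; exact: square_wave_bound.
have iaw : mu.-integrable setT (EFin \o (fun x => `|w x|)) by exact: integrable_norm.
have -> : 'N[mu]_1[EFin \o w]%E = (\int[mu]_x `|w x|)%:E.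
  by rewrite Lnorm1 /Rintegral fineK// ; exact: integrable_fin_num.
rewrite -EFinM lee_fin -RintegralZl//.
rewrite (le_trans (le_normr_Rintegral _ _))//.
apply: le_Rintegral => //.
- exact: integrable_norm.
- apply: (@integrable_boundedM _ _ _ _ (cst 3)) => //.
  by exists 3 => x; rewrite ger0_norm.
- by move=> x _; rewrite normrM ler_wpM2r// square_wave_bound.
Qed.

(** The multiplier is real, so it also relates the real parts of the transforms of the solution and
    of the datum, which at [axis n k] are cosine integrals. *)
Lemma Rintegral_cos_solution alpha gamma a v k t : 0 < gamma -> 0 < k -> 0 <= t ->
  is_solution alpha gamma a v ->
  \int[mu]_x (cos (k * tnth x ord0) * v t x) =
  expR (- (t * a * k `^ alpha)) * ((2 * gamma) ^+ n.+1 * sin (k * gamma) / k).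
Proof.
move=> g0 k0 t0 [v0 /(_ t t0)[_ /(_ (axis n k))]].
rewrite enorm_scalet_axis ?ltW// => /(congr1 (@complex.Re R)).
rewrite Re_fourier_axis => ->; rewrite -(Rintegral_cos_initial_datum n k gamma)//.
rewrite -v0 -Re_fourier_axis.
by case: fourier => x y /=; rewrite mul0r subr0.
Qed.

Lemma sin_odd_pihalf j : sin (j.*2.+1%:R * (pi / 2)) = (-1) ^+ j :> R.
Proof.
elim: j => [|j IH]; first by rewrite mul1r sin_pihalf.
have -> : j.+1.*2.+1%:R * (pi / 2) = j.*2.+1%:R * (pi / 2) + pi :> R.
  rewrite doubleS -[j.*2.+3]addn2 natrD mulrDl; congr (_ + _).
  by rewrite mulrC divfK// pnatr_eq0.
by rewrite sinDpi IH exprS mulN1r.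
Qed.

End lower_bound.

(** * Lower bound for the L^1 distance of two solutions *)

Section solution_bound.
Context {R : realType} {n : nat}.
Local Notation mu := (@lebesgue_tuple R n.+1).
Implicit Types (t M alpha gamma a b s : R).

(** With z = (b - a) x, this is z <= exp z - 1 multiplied by exp (- b x). *)
Lemma expRN_diff_ge a b (x : R) : (b - a) * x * expR (- (b * x)) <=
  expR (- (a * x)) - expR (- (b * x)).
Proof.
have -> : - (a * x) = (b - a) * x + - (b * x) by ring.
rewrite expRD -[X in _ <= _ - X]mul1r -mulrBl ler_wpM2r ?expR_ge0//.
by rewrite lerBrDl expR_ge1Dx.
Qed.

(** Here exp (- M) bounds the exponentials from below, and with kappa = pi / (2 gamma) the amplitude
    (2 gamma)^(n+1) / kappa meets the factor kappa^alpha of the symbol. The 6 is the bound 3 of the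
    square wave times the 2 in [exists_rate_le_sum]. *)
Definition coef alpha gamma M : R :=
  expR (- M) * (2 * gamma) ^+ n.+1 * (pi / (2 * gamma)) `^ (alpha - 1) / 6.

Lemma coef_gt0 alpha gamma M : 0 < gamma -> 0 < coef alpha gamma M.
Proof.
move=> g0; have p0 := pi_gt0 R; rewrite /coef !(mulr_gt0, divr_gt0)//.
- exact: expR_gt0.
- by rewrite exprn_gt0// mulr_gt0.
- by rewrite powR_gt0// divr_gt0// mulr_gt0.
Qed.

(** The free parameter [s] fixes how many frequencies are kept, and [M] bounds the exponents at
    those frequencies. The three limits take for s the maximum of a and b, then T, then (pi /
    gamma)^alpha. *)
Lemma Lnorm1_solution_ge alpha gamma a b t s M (v w : R -> n.+1.-tuple R -> R) :
  0 <= alpha <= 2 -> 0 < gamma -> 0 < a -> 0 < b -> 0 <= t -> 0 < s <= 1 ->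
  is_solution alpha gamma a v -> is_solution alpha gamma b w ->
  t * Num.max a b * (pi / gamma) `^ alpha <= M * s ->
  ((coef alpha gamma M * t * `|a - b| * rate alpha s)%:E <=
   'N[mu]_1[EFin \o (fun x => v t x - w t x)%R])%E.
Proof.
move=> al g0 a0 b0 t0 s01 sv sw.
wlog ab : a b v w a0 b0 sv sw / a <= b.
  move=> H; case/orP: (le_total a b) => [ab|ba]; first exact: (H a b v w).
  rewrite maxC distrC => h.
  rewrite (_ : 'N[mu]_1[_]%E = 'N[mu]_1[EFin \o (fun x => w t x - v t x)%R]%E).
    exact: (H b a w v).
  by rewrite !Lnorm1; apply: eq_integral => x _ /=; rewrite distrC.
rewrite max_r// ler0_norm ?subr_le0// opprB => tM.
have p0 := pi_gt0 R.
have M0 : 0 <= M.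
  case/andP: s01 => s0 _; rewrite -(pmulr_lge0 _ s0) (le_trans _ tM)//.
  by rewrite !mulr_ge0 ?powR_ge0// ltW.
have [m [sm mS]] := exists_rate_le_sum _ _ al s01.
(* At the odd multiples k of this frequency, sin (k gamma) = (-1)^j cancels the sign of the square
   wave. *)
pose kap := pi / (2 * gamma).
have kap0 : 0 < kap by rewrite divr_gt0// mulr_gt0.
have [_ /(_ t t0) [iv _]] := sv; have [_ /(_ t t0) [iw _]] := sw.
have ivw : mu.-integrable setT (EFin \o (fun x => v t x - w t x)).
  have -> : EFin \o (fun x => v t x - w t x) = ((EFin \o v t) \- (EFin \o w t))%E.
    by apply/funext.
  exact: integrableB.
have := Rintegral_square_wave_le kap _ m ivw.
rewrite Rintegral_square_wave//.
pose k j : R := j.*2.+1%:R * kap.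
have k0 j : 0 < k j by rewrite mulr_gt0 ?ltr0n.
have termE j : (-1) ^+ j / j.*2.+1%:R *
    \int[mu]_x (cos (k j * tnth x ord0) * (v t x - w t x)) =
    (2 * gamma) ^+ n.+1 / (j.*2.+1%:R ^+ 2 * kap) *
    (expR (- (a * (t * k j `^ alpha))) - expR (- (b * (t * k j `^ alpha)))).
  under eq_Rintegral do rewrite mulrBr.
  rewrite RintegralB ?integrable_cosM//.
  rewrite (Rintegral_cos_solution _ _ _ _ _ _ g0 (k0 j) t0 sv).
  rewrite (Rintegral_cos_solution _ _ _ _ _ _ g0 (k0 j) t0 sw) -mulrBl.
  have -> : k j * gamma = j.*2.+1%:R * (pi / 2).
    by rewrite /k /kap; field; rewrite gt_eqF.
  rewrite sin_odd_pihalf -!(mulrA t) !(mulrCA t).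
  have ee : (-1) ^+ j * (-1) ^+ j = 1 :> R by rewrite -exprMn mulrNN mulr1 expr1n.
  have o0 : j.*2.+1%:R != 0 :> R by rewrite pnatr_eq0.
  rewrite /k; set A := expR _ - _.
  move: (j.*2.+1%:R : R) o0 A (gt_eqF kap0) => o o0 A kn0.
  rewrite -[RHS]mul1r -[X in _ = X * _]ee.
  move: ((-1) ^+ j : R) => e; clearbody kap.
  by field; rewrite o0 kn0.
have term_ge j : (j < m)%N ->
    6 * coef alpha gamma M * t * (b - a) * j.*2.+1%:R `^ (alpha - 2) <=
    (-1) ^+ j / j.*2.+1%:R *
      \int[mu]_x (cos (k j * tnth x ord0) * (v t x - w t x)).
  move=> jm; rewrite termE.
  (* For j < m the frequency is at most m pi / gamma, and the choice of m makes s m^alpha <= 1. *)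
  have kM : b * (t * k j `^ alpha) <= M.
    have kj : k j `^ alpha <= m%:R `^ alpha * (pi / gamma) `^ alpha.
      rewrite -powRM//; last by rewrite divr_ge0// ltW.
      apply: ge0_ler_powR.
      - by case/andP: al.
      - by rewrite nnegrE ltW.
      - by rewrite nnegrE mulr_ge0 ?divr_ge0// ltW.
      - have -> : m%:R * (pi / gamma) = m.*2%:R * kap.
          by rewrite -mul2n natrM /kap; field; rewrite gt_eqF.
        by rewrite ler_pM2r// ler_nat ltn_double.
    apply: (@le_trans _ _ (t * b * (pi / gamma) `^ alpha * m%:R `^ alpha)).
      rewrite mulrCA -!mulrA ler_wpM2l// ler_wpM2l ?(ltW b0)//.
      by rewrite mulrC in kj.
    apply: (@le_trans _ _ (M * s * m%:R `^ alpha)).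
      by rewrite ler_wpM2r ?powR_ge0.
    by rewrite -mulrA ler_piMr.
  apply: (@le_trans _ _ ((2 * gamma) ^+ n.+1 / (j.*2.+1%:R ^+ 2 * kap) *
      ((b - a) * (t * k j `^ alpha) * expR (- M)))).
    rewrite le_eqVlt; apply/orP; left; apply/eqP.
    rewrite /coef -/kap /k powRM ?ler0n ?(ltW kap0)//.
    have -> : kap `^ (alpha - 1) = kap `^ alpha / kap.
      by rewrite powRB ?(gt_eqF kap0) ?implybT// (powRr1 (ltW kap0)).
    have -> : j.*2.+1%:R `^ (alpha - 2) = j.*2.+1%:R `^ alpha / j.*2.+1%:R ^+ 2 :> R.
      by rewrite powRB ?pnatr_eq0 ?implybT// powR_mulrn.
    have o0 : j.*2.+1%:R != 0 :> R by rewrite pnatr_eq0.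
    move: (j.*2.+1%:R : R) o0 (gt_eqF kap0) => o o0.
    clearbody kap => kn0.
    by field; rewrite o0 kn0.
  apply: ler_wpM2l.
    have g1 : 0 <= 2 * gamma by rewrite mulr_ge0// ltW.
    by rewrite (divr_ge0 (exprn_ge0 _ g1))// (mulr_ge0 _ (ltW kap0))// exprn_ge0.
  apply: le_trans (expRN_diff_ge _ _ _).
  rewrite ler_wpM2l ?ler_expR ?lerN2//.
  by rewrite !mulr_ge0 ?subr_ge0 ?powR_ge0.
move=> h.
rewrite -(@lee_pmul2l _ 3%:E)//; apply: le_trans h; rewrite -EFinM lee_fin.
apply: le_trans (ler_norm _).
apply: (@le_trans _ _ (\sum_(j < m)
    6 * coef alpha gamma M * t * (b - a) * j.*2.+1%:R `^ (alpha - 2))); last first.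
  by apply: ler_sum => j _; exact: term_ge.
rewrite -mulr_sumr.
have -> : 3 * (coef alpha gamma M * t * (b - a) * rate alpha s) =
  6 * coef alpha gamma M * t * (b - a) * (rate alpha s / 2) by field.
apply: ler_wpM2l => //.
rewrite (mulr_ge0 (mulr_ge0 (mulr_ge0 _ (ltW (coef_gt0 _ _ _ g0))) t0))//.
by rewrite subr_ge0.
Qed.

End solution_bound.

(** * Comparison of the rate with the moduli of the theorem *)

Section omega_sigma.
Context {R : realType}.
Implicit Types (alpha a b c gamma M s K T : R).

(** Let b <= a. For alpha > 1, x^(1/alpha) = x x^(1/alpha - 1), whose last factor is nonincreasing.
    For alpha = 1, a ln a - b ln b = (a - b) ln a + b (ln a - ln b) with last term between 0 and a -
    b; below the threshold exp (-1), ln a <= -1 makes the whole nonpositive. *)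
Lemma omega_le alpha a b : 0 < a -> 0 < b -> Num.max a b <= expR (- 1) ->
  omega alpha a b <= `|a - b| * rate alpha (Num.max a b).
Proof.
wlog ba : a b / b <= a.
  move=> H; case/orP: (le_total b a) => [ba|ab]; first exact: (H a b).
  move=> a0 b0; rewrite maxC distrC => /(H b a ab b0 a0).
  by rewrite /omega ![in X in _ -> X](distrC (a * _))
    ![in X in _ -> X](distrC (a `^ _)) ![in X in _ -> X](distrC a).
move=> a0 b0; rewrite max_l// (ger0_norm (x := a - b)) ?subr_ge0// => ae.
rewrite /omega /rate; case: ifPn => a1; last case: ifPn => _.
- have p0 : 0 <= alpha^-1 by rewrite invr_ge0 ltW// (lt_trans _ a1).
  have p1 : alpha^-1 - 1 <= 0.
    by rewrite subr_le0 invf_le1 ?(ltW a1)// (lt_trans _ a1).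
  rewrite ger0_norm; last by rewrite subr_ge0 ge0_ler_powR ?nnegrE// ltW.
  have E x : 0 < x -> x `^ alpha^-1 = x * x `^ (alpha^-1 - 1).
    move=> x0; rewrite -[X in X * _](powRr1 (ltW x0)) -powRD.
      by rewrite addrC subrK.
    by rewrite (gt_eqF x0) implybT.
  by rewrite (E a)// (E b)// mulrBl lerB// ler_wpM2l ?(ltW b0)// ler_powR_npos.
- have lnba : b * ln b <= b * ln a by rewrite ler_wpM2l ?(ltW b0)// ler_ln.
  have lna : ln a <= -1 by rewrite -[leRHS](expRK) ler_ln ?posrE ?expR_gt0.
  have : b * (ln a - ln b) <= a - b.
    rewrite -ln_div ?posrE// mulrC -ler_pdivlMr// mulrBl divff ?gt_eqF//.
    have -> : a / b = 1 + (a / b - 1) by rewrite addrC subrK.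
    rewrite (le_trans (le_ln1Dx _)) ?ltrBrDr ?addNr ?divr_gt0//.
    by rewrite addrAC subrr add0r.
  have : 0 <= (a - b) * (- 1 - ln a) by rewrite mulr_ge0 ?subr_ge0.
  have : 0 <= (a - b) by rewrite subr_ge0.
  move: lnba; rewrite ler_norml => h1 h2 h3 h4; apply/andP; split; last by nra.
  by nra.
- by rewrite mulr1 ger0_norm// subr_ge0.
Qed.

Lemma rate_gt0 alpha s : 0 < s < 1 -> 0 < rate alpha s.
Proof.
move=> s01; rewrite /rate; case: ifPn => _.
  by rewrite powR_gt0//; case/andP: s01.
by case: ifPn => // _; rewrite oppr_gt0 ln_lt0.
Qed.

Lemma sigmaTE alpha T : 0 < T < 1 -> sigmaT alpha T = T * rate alpha T.
Proof.
move=> T01; case/andP: (T01) => T0 _; rewrite /sigmaT /rate.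
case: ifPn => a1; last case: ifPn => _; last by rewrite mulr1.
- rewrite -[X in _ = X * _](powRr1 (ltW T0)) -powRD; first by rewrite addrC subrK.
  by rewrite (gt_eqF T0) implybT.
- by rewrite ltr0_norm ?ln_lt0.
Qed.

Lemma sigmag_gt0 d alpha gamma : 1 < gamma -> 0 < sigmag d alpha gamma.
Proof.
move=> g1; have g0 : 0 < gamma by apply: lt_trans g1.
rewrite /sigmag; case: ifPn => _; first by rewrite exprn_gt0.
by case: ifPn => _; rewrite ?powR_gt0// mulr_gt0 ?exprn_gt0 ?ln_gt0.
Qed.

(** The coefficient is a multiple of gamma^(n+1) gamma^(1 - alpha). For alpha > 1 the rate is (pi /
    gamma)^(1 - alpha), which cancels the second power up to a constant. For alpha = 1 it is ln
    gamma - ln pi, at least half of ln gamma once gamma >= pi^2. For alpha < 1 it is 1. *)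
Lemma sigmag_le n alpha M : 0 <= alpha -> exists2 K, 0 < K &
  forall gamma, pi ^+ 2 <= gamma ->
    K * sigmag n.+1 alpha gamma <=
    @coef R n alpha gamma M * rate alpha ((pi / gamma) `^ alpha).
Proof.
move=> alpha0; have p0 := pi_gt0 R; have p1 : 1 < pi :> R.
  by rewrite (lt_le_trans _ (pi_ge2 R))// ltr1n.
pose A : R := expR (- M) * 2 ^+ n.+1 / 6 * (pi / 2) `^ (alpha - 1).
have A0 : 0 < A.
  by rewrite /A !(mulr_gt0, divr_gt0) ?expR_gt0 ?exprn_gt0 ?powR_gt0 ?divr_gt0.
have coefE gamma : 0 < gamma ->
    @coef R n alpha gamma M = A * (gamma ^+ n.+1 * gamma `^ (1 - alpha)).
  move=> g0; rewrite /coef /A exprMn.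
  have -> : pi / (2 * gamma) = pi / 2 * gamma^-1 by rewrite invfM mulrA.
  rewrite powRM ?invr_ge0 ?divr_ge0 ?(ltW p0) ?(ltW g0)//.
  have -> : gamma^-1 `^ (alpha - 1) = gamma `^ (1 - alpha).
    by rewrite -powR_inv1 ?(ltW g0)// -powRrM; congr (_ `^ _); ring.
  by ring.
have g1 gamma : pi ^+ 2 <= gamma -> 1 < gamma.
  by move=> /(lt_le_trans _); apply; rewrite exprn_egt1.
have g0 gamma : pi ^+ 2 <= gamma -> 0 < gamma.
  by move=> /g1; apply: lt_trans.
have powNV gamma : 0 < gamma -> gamma `^ (1 - alpha) * gamma `^ (alpha - 1) = 1.
  move=> h; rewrite -powRD; last by rewrite (gt_eqF h) implybT.
  by rewrite addrC subrKA subrr powRr0.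
rewrite /sigmag /rate; case: (ltP 1 alpha) => [a1|_];
  last case: (eqVneq alpha 1) => [ae|_].
- exists (A * pi `^ (1 - alpha)); first by rewrite mulr_gt0 ?powR_gt0.
  move=> gamma gg; have h := g0 _ gg; rewrite coefE// -powRrM.
  have -> : alpha * (alpha^-1 - 1) = 1 - alpha.
    by field; rewrite gt_eqF// (lt_trans _ a1).
  rewrite powRM ?invr_ge0 ?(ltW p0) ?(ltW h)//.
  have -> : gamma^-1 `^ (1 - alpha) = gamma `^ (alpha - 1).
    by rewrite -powR_inv1 ?(ltW h)// -powRrM; congr (_ `^ _); ring.
  rewrite [leRHS](_ : _ = A * pi `^ (1 - alpha) * gamma ^+ n.+1 *
    (gamma `^ (1 - alpha) * gamma `^ (alpha - 1))); last by ring.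
  by rewrite powNV// mulr1.
- exists (A / 2); first by rewrite divr_gt0.
  move=> gamma gg; have h := g0 _ gg.
  rewrite coefE// ae subrr powRr0 mulr1 powRr1 ?divr_ge0 ?(ltW p0) ?(ltW h)//.
  have : 2 * ln pi <= ln gamma.
    by rewrite mulr_natl -lnXn// ler_ln ?posrE// exprn_gt0.
  have G0 : 0 < A * gamma ^+ n.+1 by rewrite mulr_gt0 ?exprn_gt0.
  rewrite ln_div ?posrE// => l2.
  have -> : A / 2 * (gamma ^+ n.+1 * ln gamma) =
    A * gamma ^+ n.+1 * (ln gamma / 2) by ring.
  by rewrite ler_pM2l//; lra.
- exists A => // gamma gg; have h := g0 _ gg; rewrite coefE// mulr1 ler_pM2l//.
  rewrite -addrA powRD; last by rewrite (gt_eqF h) implybT.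
  by rewrite powR_mulrn// ltW.
Qed.

End omega_sigma.

(** * Lower limits, the Lipschitz constant and the three estimates *)

Section limits.
Context {R : realType}.

(* The case r = 0 relies on the convention 0^-1 = +oo in \bar R. *)
Lemma lee_divr (K r : R) (D : \bar R) : (0 < D)%E -> 0 <= r ->
  ((K * r)%:E <= D)%E -> (K%:E <= D / r%:E)%E.
Proof.
move=> D0; rewrite le_eqVlt => /predU1P[<- _|r0 h].
  by rewrite inve0 gt0_muley// leey.
by rewrite inver gt_eqF// lee_pdivlMr// -EFinM.
Qed.

(** A lower limit is a supremum of infima over the sets of the filter, and the set where f >= K is
    one of them. *)
Lemma limf_einf_gt0 {T : choiceType} {X : filteredType T} (f : X -> \bar R)
    (F : set_system X) (K : R) : 0 < K -> F [set x | (K%:E <= f x)%E] ->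
  (0 < limf_einf f F)%E.
Proof.
move=> K0 FK; rewrite limf_einfE (@lt_le_trans _ _ K%:E)//.
apply: ereal_sup_ge; eexists; first by exists [set x | (K%:E <= f x)%E].
by apply: le_ereal_inf_tmp => _ [x /= h <-].
Qed.

Lemma distCL1_ge d (T t : R) (v w : R -> d.-tuple R -> R) : 0 <= t <= T ->
  ('N[lebesgue_tuple d]_1[EFin \o (fun x => v t x - w t x)%R] <= distCL1 T v w)%E.
Proof. by move=> tT; apply: ereal_sup_ubound; exists t. Qed.

Lemma Lip_ge d (T c K : R) (u : R -> R -> d.-tuple R -> R) : 0 < c -> 0 < K ->
  (forall a b, 0 < a < 2 * c -> 0 < b < 2 * c ->
    ((K * `|a - b|)%:E <= distCL1 T (u a) (u b))%E) ->
  (K%:E <= Lip T u c)%E.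
Proof.
move=> c0 K0 H; rewrite /Lip limf_esupE; apply: le_ereal_inf_tmp => _ [A FA <-].
have [e /= e0 eA] := (nbhs_ballP _ _).1 FA.
(* Half of the smaller of e and c keeps (a, c) in the ball and a below 2 c. *)
pose a := c + Num.min e c / 2.
have m0 : 0 < Num.min e c by rewrite lt_min e0.
have ac : c < a by rewrite ltrDl divr_gt0.
have m1 : Num.min e c <= e by rewrite ge_min lexx.
have m2 : Num.min e c <= c by rewrite ge_min lexx orbT.
have Aac : A (a, c).
  apply: eA => /=.
    split; last exact: ballxx.
    by rewrite /ball/= ler0_norm /a; lra.
  by split => //=; [lra|rewrite gt_eqF].
apply: ereal_sup_ge; eexists; first by exists (a, c).
have h : ((K * `|a - c|)%:E <= distCL1 T (u a) (u c))%E.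
  by apply: H; rewrite /a; lra.
have d0 : 0 < `|a - c| by rewrite normr_gt0 subr_eq0 gt_eqF.
apply: lee_divr => //=.
by apply: lt_le_trans h; rewrite lte_fin mulr_gt0.
Qed.

End limits.

(* u gamma a t x is the value at (x, t) of the solution u_a for gamma. *)
Theorem proposition8p1 (R : realType) (d : nat) (alpha c : R)
    (u : R -> R -> R -> d.-tuple R -> R) :
  (1 <= d)%N -> 0 <= alpha <= 2 -> 0 < c ->
  (forall gamma a, 0 < gamma -> 0 < a ->
     is_solution alpha gamma a (u gamma a)) ->
  [/\ forall T gamma, 0 < T -> 0 < gamma ->
        (0 < limf_einf (fun p : R * R =>
               distCL1 T (u gamma p.1) (u gamma p.2) / (omega alpha p.1 p.2)%:E)
             (distinct_pos_pairs 0))%E,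
      forall gamma, 0 < gamma ->
        (0 < limf_einf (fun T => Lip T (u gamma) c / (sigmaT alpha T)%:E)
             0^'+)%E
    & forall T, 0 < T ->
        (0 < limf_einf (fun gamma =>
               Lip T (u gamma) c / (sigmag d alpha gamma)%:E)
             (+oo%R : set_system R))%E].
Proof.
case: d u => // n u _ al c0 sol.
have p0 := pi_gt0 R.
have dist_ge T gamma a b s M : 0 < T -> 0 < gamma -> 0 < a -> 0 < b -> 0 < s <= 1 ->
    T * Num.max a b * (pi / gamma) `^ alpha <= M * s ->
    ((@coef R n alpha gamma M * T * `|a - b| * rate alpha s)%:E <=
     distCL1 T (u gamma a) (u gamma b))%E.
  move=> T0 g0 a0 b0 s01 h.
  (* The supremum over [0, T] is bounded below by the value at t = T. *)
  have TT : 0 <= T <= T by rewrite lexx (ltW T0).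
  apply: le_trans (distCL1_ge _ _ _ _ _ TT).
  by apply: Lnorm1_solution_ge h => //; [exact: ltW|exact: sol..].
have Lip_ge_rate T gamma s M : 0 < T -> 0 < gamma -> 0 < s <= 1 ->
    0 < rate alpha s ->
    T * (2 * c) * (pi / gamma) `^ alpha <= M * s ->
    ((@coef R n alpha gamma M * T * rate alpha s)%:E <= Lip T (u gamma) c)%E.
  move=> T0 g0 s01 r0 h; apply: Lip_ge => //.
    by rewrite (mulr_gt0 (mulr_gt0 (coef_gt0 _ _ _ g0) T0)).
  move=> a b /andP[a0 ac] /andP[b0 bc]; rewrite mulrAC; apply: dist_ge => //.
  apply: le_trans h; rewrite ler_wpM2r ?powR_ge0// ler_wpM2l ?ltW//.
  by rewrite gt_max ac.
split.
(* With s the maximum of a and b, this M turns the condition of [dist_ge] into an equality. *)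
- move=> T gamma T0 g0; pose M := T * (pi / gamma) `^ alpha.
  have K0 : 0 < @coef R n alpha gamma M * T by rewrite mulr_gt0// coef_gt0.
  apply: (limf_einf_gt0 _ _ _ K0).
  (* The radius exp (-1) is the threshold of [omega_le]. *)
  apply: filterS (nbhsx_ballx (0 : R, 0 : R) _ (expR_gt0 (- 1))).
  move=> [a b] [/=]; rewrite /ball/= !sub0r !normrN => ae be [/= a0 b0 ab].
  rewrite gtr0_norm// in ae; rewrite gtr0_norm// in be.
  have m0 : 0 < Num.max a b by rewrite lt_max a0.
  have me : Num.max a b < expR (- 1) by rewrite gt_max ae.
  have m1 : Num.max a b < 1 by rewrite (lt_trans me)// expR_lt1// ltrN10.
  have h : ((@coef R n alpha gamma M * T * `|a - b| * rate alpha (Num.max a b))%:E <=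
     distCL1 T (u gamma a) (u gamma b))%E.
    apply: dist_ge => //; first by rewrite m0 ltW.
    by rewrite /M mulrAC.
  apply: lee_divr.
  + apply: lt_le_trans h; rewrite lte_fin (mulr_gt0 (mulr_gt0 K0 _))//.
      by rewrite normr_gt0 subr_eq0.
    by rewrite rate_gt0 ?m0.
  + by rewrite /omega; case: ifPn => _; [|case: ifPn => _].
  + apply: le_trans h; rewrite lee_fin -[leRHS]mulrA ler_wpM2l ?(ltW K0)//.
    by apply: omega_le => //; exact: ltW.
(* Here s = T, so that M does not depend on T. *)
- move=> gamma g0; pose M := 2 * c * (pi / gamma) `^ alpha.
  apply: (limf_einf_gt0 _ _ _ (coef_gt0 (n := n) alpha _ M g0)).
  near=> T => /=.
  have T0 : 0 < T by near: T; exact: nbhs_right_gt.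
  have T1 : T < 1 by near: T; exact: nbhs_right_lt.
  have T01 : 0 < T < 1 by rewrite T0.
  have sT0 : 0 < sigmaT alpha T by rewrite sigmaTE// mulr_gt0// rate_gt0.
  have h :
    ((coef (n := n) alpha gamma M * sigmaT alpha T)%:E <= Lip T (u gamma) c)%E.
    rewrite sigmaTE// mulrA; apply: Lip_ge_rate; rewrite ?T0 ?(ltW T1) ?rate_gt0//.
    by rewrite /M -mulrA mulrC.
  apply: lee_divr; [|exact: ltW|by []].
  by apply: lt_le_trans h; rewrite lte_fin mulr_gt0// coef_gt0.
(* Here s = (pi / gamma)^alpha, so that M, and with it K, does not depend on gamma. *)
- move=> T T0; pose M := T * (2 * c).
  have [|K K0 HK] := @sigmag_le R n alpha M; first by case/andP: al.
  apply: (limf_einf_gt0 _ _ _ (mulr_gt0 K0 T0)).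
  near=> gamma => /=.
  have gp : pi ^+ 2 <= gamma by near: gamma; apply: nbhs_pinfty_ge; exact: num_real.
  have p1 : 1 < pi :> R by rewrite (lt_le_trans _ (pi_ge2 R))// ltr1n.
  have gpi : pi < gamma by rewrite (lt_le_trans _ gp)// expr2 ltr_pMr.
  have g1 : 1 < gamma by apply: lt_trans gpi.
  have g0 : 0 < gamma by apply: lt_trans g1.
  have s0 : 0 < (pi / gamma) `^ alpha by rewrite powR_gt0// divr_gt0.
  have s1 : (pi / gamma) `^ alpha <= 1.
    rewrite -(powRr0 (pi / gamma)) ger_powR ?divr_gt0//=; last by case/andP: al.
    by rewrite ler_pdivrMr// mul1r ltW.
  have sg0 := @sigmag_gt0 R n.+1 alpha gamma g1.
  (* For alpha = 0 the parameter s equals 1, outside the range of [rate_gt0]; positivity is read off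
     [sigmag_le] instead. *)
  have r0 : 0 < rate alpha ((pi / gamma) `^ alpha).
    rewrite -(pmulr_rgt0 _ (coef_gt0 (n := n) alpha _ M g0)).
    by apply: lt_le_trans (HK _ gp); rewrite mulr_gt0.
  have h : ((K * T * sigmag n.+1 alpha gamma)%:E <= Lip T (u gamma) c)%E.
    have := Lip_ge_rate T gamma ((pi / gamma) `^ alpha) M T0 g0 _ r0.
    rewrite s0 s1 => /(_ isT (lexx _)); apply: le_trans.
    by rewrite lee_fin (mulrAC K) (mulrAC _ T) ler_pM2r// HK.
  apply: lee_divr; [|exact: ltW|by []].
  by apply: lt_le_trans h; rewrite lte_fin !mulr_gt0.
Unshelve. all: end_near.
Qed.
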